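(* Assume the PRIS-ARIS-NOMA model described in the context, with imperfect successive interference cancellation (ipSIC). Let $R_{D_n,ipSIC}^{ergodic}(P_s^a)=\mathbb{E}\left[\log_2(1+\gamma_{D_n})\right]$ be the ergodic data rate of the nearby user $D_n$ at transmit power $P_s^a$. Then, with all other parameters fixed, $R_{D_n,ipSIC}^{ergodic}(P_s^a)$ converges to a constant value as $P_s^a\to\infty$, and the ergodic data rate slope of $D_n$ with ipSIC is zero, i.e. $$\lim_{P_s^a\to\infty}\frac{R_{D_n,ipSIC}^{ergodic}(P_s^a)}{\log_2P_s^a}=0.$$
   Context: Parameters: integers $M,N\ge 1$ (numbers of reflecting elements of the active RIS (ARIS) and the passive RIS (PRIS)); ARIS amplification factor $\beta>1$; transmit power $P_s^a>0$; power allocation factors $a_n,a_m>0$ with $a_n+a_m=1$; noise powers $\sigma_a^2,\sigma^2>0$; residual interference power $\Omega_{RI}>0$; Rician factor $\kappa>0$; Nakagami shape parameter $m_{na}>0$ and scale parameter $\Omega_{na}>0$; path loss $\eta>0$, path loss exponent $\alpha>0$, distances $d_{h1},d_{h2},d_{g1},d_{gn}>0$; $\overline{\lambda_n}=\eta^{-4}d_{h1}^{\alpha}d_{h2}^{\alpha}d_{g1}^{\alpha}d_{gn}^{\alpha}$. Channel statistics (cascaded Rician and Nakagami-$m$ fading, approximate distributions): let $e_\varphi=\sqrt{\frac{\pi}{4(\kappa+1)}}\,\frac{\Gamma(m_{na}+\frac12)}{\Gamma(m_{na})}\,m_{na}^{-1/2}\,L_{1/2}(-\kappa)$ and $d_\varphi=1-\frac{L_{1/2}^2(-\kappa)}{4(\kappa+1)}\cdot\frac{\pi}{m_{na}}\left(\frac{\Gamma(m_{na}+\frac12)}{\Gamma(m_{na})}\right)^2$,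 where $L_{1/2}(-\kappa)=e^{-\kappa/2}\left[(1+\kappa)I_0(\kappa/2)+\kappa I_1(\kappa/2)\right]$ with $I_0,I_1$ modified Bessel functions of the first kind. Put $a_X=\frac{Ne_\varphi^2}{d_\varphi}-1$, $a_Y=\frac{Me_\varphi^2}{d_\varphi}-1$, $b_X=b_Y=\frac{d_\varphi}{e_\varphi}$. The cascaded channel gains $\zeta_h,\zeta_g$ are independent positive random variables with densities $f_{\zeta_h}(x)=\frac{x^{(a_X-1)/2}}{2b_X^{a_X+1}\Gamma(a_X+1)}e^{-\sqrt{x}/b_X}$ and $f_{\zeta_g}(y)=\frac{y^{(a_Y-1)/2}}{2b_Y^{a_Y+1}\Gamma(a_Y+1)}e^{-\sqrt{y}/b_Y}$ on $(0,\infty)$. The residual interference gain $|h_{RI}|^2$ is exponential with mean $\Omega_{RI}$ and independent of $(\zeta_h,\zeta_g)$. SINR of $D_n$ for its own signal (ipSIC): $$\gamma_{D_n}=\frac{\beta P_s^aa_n\,\zeta_h\zeta_g/\overline{\lambda_n}}{P_s^a|h_{RI}|^2+\beta\sigma_a^2M\Omega_{na}+\sigma^2}.$$ *)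

(* Defs.v *)
From HB Require Import structures.
From mathcomp Require Import all_boot all_order all_algebra.
From mathcomp Require Import all_classical all_reals all_analysis.

Set Implicit Arguments.
Unset Strict Implicit.
Unset Printing Implicit Defensive.

Import Order.TTheory GRing.Theory Num.Theory.
Import numFieldNormedType.Exports.

Local Open Scope classical_set_scope.
Local Open Scope ring_scope.

Definition log2 {R : realType} (x : R) : R := ln x / ln 2.

(* Euler's integral; the Rintegral takes the junk value 0 when s <= 0. *)
Definition Gamma {R : realType} (s : R) : R :=
  \int[lebesgue_measure]_(t in `]0, +oo[) (t `^ (s - 1) * expR (- t)).

(* Modified Bessel function of the first kind, of integer order n:
   I_n(x) = \sum_k (x/2)^(2k+n) / (k! Gamma(k+n+1)). *)
Definition besselI {R : realType} (n : nat) (x : R) : R :=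
  limn (series (fun k : nat =>
    (x / 2) ^+ (k.*2 + n) / (k`! * (k + n)`!)%:R)).

(* L_{1/2}(- kappa), as a function of kappa. *)
Definition laguerre_half_opp {R : realType} (kappa : R) : R :=
  expR (- kappa / 2) *
    ((1 + kappa) * besselI 0 (kappa / 2) + kappa * besselI 1 (kappa / 2)).

Definition e_phi {R : realType} (kappa m_na : R) : R :=
  Num.sqrt (pi / (4 * (kappa + 1))) * (Gamma (m_na + 1 / 2) / Gamma m_na) *
  m_na `^ (- (1 / 2)) * laguerre_half_opp kappa.

Definition d_phi {R : realType} (kappa m_na : R) : R :=
  1 - laguerre_half_opp kappa ^+ 2 / (4 * (kappa + 1)) * (pi / m_na) *
      (Gamma (m_na + 1 / 2) / Gamma m_na) ^+ 2.

(* a_X is shape_a N and a_Y is shape_a M; b_X = b_Y is scale_b. *)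
Definition shape_a {R : realType} (K : nat) (kappa m_na : R) : R :=
  K%:R * e_phi kappa m_na ^+ 2 / d_phi kappa m_na - 1.

Definition scale_b {R : realType} (kappa m_na : R) : R :=
  d_phi kappa m_na / e_phi kappa m_na.

Definition cascaded_gain_pdf {R : realType} (a b x : R) : R :=
  x `^ ((a - 1) / 2) / (2 * b `^ (a + 1) * Gamma (a + 1)) *
  expR (- Num.sqrt x / b).

(* The law of X is f(x) dx on (0, +oo); as it has no mass elsewhere, X is
   then almost surely positive. *)
Definition has_density_on_pos {d} {T : measurableType d} {R : realType}
    (P : probability T R) (X : {RV P >-> R}) (f : R -> R) : Prop :=
  forall A : set R, measurable A ->
    distribution P X A =
    (\int[lebesgue_measure]_(x in A `&` `]0%R, +oo[) (f x)%:E)%E.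

(* The library parametrises exponential laws by the rate. *)
Definition exponential_with_mean {d} {T : measurableType d} {R : realType}
    (P : probability T R) (X : {RV P >-> R}) (mean : R) : Prop :=
  forall A : set R, measurable A ->
    distribution P X A = exponential_prob mean^-1 A.

Definition independent {d d1 d2} {T : measurableType d}
    {T1 : measurableType d1} {T2 : measurableType d2} {R : realType}
    (P : probability T R) (X : T -> T1) (Y : T -> T2) : Prop :=
  forall (A : set T1) (B : set T2), measurable A -> measurable B ->
    P (X @^-1` A `&` Y @^-1` B) = (P (X @^-1` A) * P (Y @^-1` B))%E.

Definition lambda_n {R : realType} (eta alpha dh1 dh2 dg1 dgn : R) : R :=
  eta ^- 4 * dh1 `^ alpha * dh2 `^ alpha * dg1 `^ alpha * dgn `^ alpha.

(* p is the transmit power P_s^a; zh, zg, g are the values of zeta_h, zeta_g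
   and |h_RI|^2. *)
Definition sinr_Dn {R : realType} (M : nat)
    (beta an sigma_a2 sigma2 Omega_na lambda p zh zg g : R) : R :=
  (beta * p * an * (zh * zg / lambda)) /
  (p * g + beta * sigma_a2 * M%:R * Omega_na + sigma2).

(* The expectation of a nonnegative variable, hence valued in [0, +oo]. *)
Definition ergodic_rate {d} {T : measurableType d} {R : realType}
    (P : probability T R) (gamma : T -> R) : \bar R :=
  ('E_P[(fun w => log2 (1 + gamma w))])%E.

(* Main.v *)
Require Import Defs.
From HB Require Import structures.
From mathcomp Require Import all_boot all_order all_algebra.
From mathcomp Require Import all_classical all_reals all_analysis.
From mathcomp Require Import measurable_realfun.
From mathcomp Require Import ring lra.
Import Order.TTheory GRing.Theory Num.Theory.
Import numFieldNormedType.Exports.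
Local Open Scope classical_set_scope.
Local Open Scope ring_scope.

(* For p > 0 the SINR is k X Y / (G + s/p), where X = zeta_h, Y = zeta_g,
   G = |h_RI|^2 and k, s > 0: it is nondecreasing in p, and by
     1 + k X Y / G <= (1 + k) (1 + X) (1 + Y) (1 + 1/G)
   the rate is at most
     ln (1 + k) + E ln (1 + X) + E ln (1 + Y) + E ln (1 + 1/G)
   up to the factor 1 / ln 2, hence converges to its finite supremum. The
   expectations are finite since both ln (1 + x) times the density of X or Y
   and ln (1 + 1/x) times the exponential density exceed the density by at most
   a multiple of 1 / (sqrt x (1 + x)), whose primitive 2 atan (sqrt x) is
   bounded. The signs of the parameters of the cascaded density, in particular
   b > 0, follow from its total mass being 1. *)

(** * Expectations as integrals against a density *)

(** A [mu]-null set has [nu]-measure 0, so the Radon-Nikodym derivative exists. It equals [f] almost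
    everywhere because both have the same integral over every measurable set, so change of variables
    transfers to [f]. *)
Lemma ge0_integral_density {d} {T : measurableType d} {R : realType}
    (nu : probability T R) (mu : {sigma_finite_measure set T -> \bar R})
    (f : T -> R) (g : T -> \bar R) :
  measurable_fun [set: T] f -> (forall x, 0 <= f x) ->
  (forall A, measurable A -> nu A = (\int[mu]_(x in A) (f x)%:E)%E) ->
  measurable_fun [set: T] g -> (forall x, (0 <= g x)%E) ->
  (\int[nu]_x g x = \int[mu]_x (g x * (f x)%:E))%E.
Proof.
move=> mf f0 nuE mg g0.
have mfE : measurable_fun [set: T] (EFin \o f) by exact/measurable_EFinP.
have numu : nu `<< mu.
  apply/null_content_dominatesP => A mA muA0; rewrite nuE//.
  apply: null_set_integral => //; exact: measurable_funTS.
rewrite -(Radon_Nikodym_SigmaFinite.change_of_variables numu)//.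
apply: ge0_ae_eq_integral => //.
- apply: emeasurable_funM => //.
  exact: measurable_int (Radon_Nikodym_SigmaFinite.f_integrable _).
- exact: emeasurable_funM.
- by move=> x _; rewrite mule_ge0//; exact: Radon_Nikodym_SigmaFinite.f_ge0.
- by move=> x _; rewrite mule_ge0// lee_fin.
apply: ae_eqe_mul2l; apply: integral_ae_eq => //.
- exact: Radon_Nikodym_SigmaFinite.f_integrable.
- by move=> A _ mA; rewrite -nuE// -(Radon_Nikodym_SigmaFinite.f_integral numu).
Qed.

Lemma ge0_integral_RV_density {d} {T : measurableType d} {R : realType}
    (P : probability T R) (X : {RV P >-> R}) (f : R -> R) (g : R -> \bar R) :
  measurable_fun [set: R] f -> (forall x, 0 <= f x) ->
  (forall A : set R, measurable A ->
    distribution P X A = (\int[lebesgue_measure]_(x in A) (f x)%:E)%E) ->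
  measurable_fun [set: R] g -> (forall x, (0 <= g x)%E) ->
  (\int[P]_w g (X w) = \int[lebesgue_measure]_x (g x * (f x)%:E))%E.
Proof.
move=> mf f0 XE mg g0.
have mX : measurable_fun [set: T] (X : T -> measurableTypeR R).
  exact: (measurable_funPT X).
(* [X] is repackaged with codomain [measurableTypeR R], so that its law and [lebesgue_measure] share
   one measurable type. *)
pose X' : {RV P >-> measurableTypeR R} :=
  @mfun_Sub _ _ T (measurableTypeR R) X (mem_set mX).
have := @ge0_integral_density _ (measurableTypeR R) R (distribution P X')
  lebesgue_measure f g mf f0 XE mg g0.
by rewrite ge0_integral_distribution.
Qed.


(** * Integrals over the half-line from primitives on compact intervals *)

Lemma derive_FTC2_pos {R : realType} (F f : R -> R) (a b : R) :
  0 < a -> a < b ->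
  (forall x : R, 0 < x -> is_derive x 1 F (f x)) ->
  (forall x : R, 0 < x -> {for x, continuous f}) ->
  (\int[lebesgue_measure]_(x in `[a, b]) (f x)%:E = (F b - F a)%:E)%E.
Proof.
move=> a0 ab dF cf; have b0 : 0 < b by exact: lt_trans ab.
have cF x : 0 < x -> {for x, continuous F}.
  move=> x0; apply/differentiable_continuous/derivable1_diffP.
  by apply: ex_derive; exact: dF.
rewrite EFinB; apply: continuous_FTC2 => //.
- apply: continuous_in_subspaceT => x /[!inE]/=.
  rewrite in_itv/= => /andP[ax _].
  by apply: cf; exact: lt_le_trans ax.
- split.
  + move=> x; rewrite in_itv/= => /andP[ax _].
    by apply: ex_derive; apply: dF; exact: lt_trans ax.
  + by apply: cvg_at_right_filter; exact: cF.
  + by apply: cvg_at_left_filter; exact: cF.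
- move=> x; rewrite in_itv/= => /andP[ax _].
  rewrite derive1E; have [] := dF x; [exact: lt_trans ax|by []].
Qed.

Lemma integral_inv_itv {R : realType} (a b : R) : 0 < a -> a < b ->
  (\int[lebesgue_measure]_(x in `[a, b]) (x^-1)%:E = (ln b - ln a)%:E)%E.
Proof.
move=> a0 ab; apply: (derive_FTC2_pos (@ln R)) => // x x0.
by apply: inv_continuous; rewrite gt_eqF.
Qed.

Lemma ge0_integral_pos_le {R : realType} (f : R -> R) (B : R) :
  measurable_fun (`]0, +oo[%classic : set R) f ->
  (forall x, 0 < x -> 0 <= f x) ->
  (forall a b, 0 < a -> a < b ->
    (\int[lebesgue_measure]_(x in `[a, b]) (f x)%:E <= B%:E)%E) ->
  (\int[lebesgue_measure]_(x in `]0%R, +oo[) (f x)%:E <= B%:E)%E.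
Proof.
move=> mf f0 fB.
(* Exhaustion of the half-line, for monotone convergence. Starting at 2 keeps the endpoints
   distinct, since [fB] demands [a < b]. *)
pose K (n : nat) : set R := `[n.+2%:R^-1, n.+2%:R]%classic.
have KE : \bigcup_n K n = `]0, +oo[%classic :> set R.
  apply/seteqP; split => [x [n _]|x]; rewrite /K/= !in_itv/= ?andbT.
    by move=> /andP[nx _]; rewrite (lt_le_trans _ nx)// invr_gt0.
  (* An [n] above [x + x^-1] dominates both [x] and [x^-1], which settles the two endpoints at
     once. *)
  move=> x0; have xV0 : 0 < x + x^-1 by rewrite addr_gt0// invr_gt0.
  have := archi_boundP (ltW xV0); set n := Num.bound _ => xn.
  have nn : n%:R <= n.+2%:R :> R by rewrite ler_nat leqW.
  exists n => //; rewrite /K/= in_itv/=; apply/andP; split.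
    rewrite -(invrK x) lef_pV2 ?posrE ?invr_gt0//.
    by rewrite (le_trans _ nn)// (le_trans _ (ltW xn))// lerDr ltW.
  by rewrite (le_trans _ nn)// (le_trans _ (ltW xn))// lerDl invr_ge0 ltW.
rewrite -KE.
have mfK i : measurable_fun (K i) (EFin \o f).
  apply/measurable_EFinP; apply: measurable_funS mf => //.
  by rewrite -KE; exact: bigcup_sup.
have Kx i x : K i x -> 0 < x.
  rewrite /K/= in_itv/= => /andP[nx _].
  by rewrite (lt_le_trans _ nx)// invr_gt0.
have ndK : nondecreasing_seq K.
  move=> m n mn; rewrite subsetEset => x.
  rewrite /K/= !in_itv/= => /andP[mx xm].
  rewrite (le_trans _ mx) ?lef_pV2 ?posrE ?ler_nat//= ?ltnS//.
  by rewrite (le_trans xm)// ler_nat !ltnS.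
have := ge0_nondecreasing_set_cvg_integral (mu := lebesgue_measure) ndK
  (fun _ => measurable_itv _) mfK (fun i x Kix => f0 x (Kx i x Kix)).
move=> cvK; rewrite -(cvg_lim _ cvK)//; apply: lime_le.
  by apply/cvg_ex; eexists; exact: cvK.
apply: nearW => n; apply: fB; first by rewrite invr_gt0.
by rewrite (@lt_trans _ _ 1)// ?invf_lt1 ?ltr1n.
Qed.

(* Holds on all of [D] as [x^-1 = x * (x^2)^-1] is 0 at [x = 0]. *)
Lemma measurable_fun_inv {d} {T : measurableType d} {R : realType}
    (D : set T) (f : T -> R) :
  measurable_fun D f -> measurable_fun D (fun x => (f x)^-1).
Proof.
move=> mf.
have -> : (fun x => (f x)^-1) = (fun x => f x * (f x ^+ 2) `^ (- 1)).
  apply/funext => x; rewrite powR_inv1 ?sqr_ge0//.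
  have [->|fx0] := eqVneq (f x) 0; first by rewrite invr0 mul0r.
  by field.
apply: measurable_funM => //.
by apply: (measurableT_comp (measurable_powR (-1))); exact: measurable_funX.
Qed.

(** * Elementary bounds on logarithms and powers *)

(** With [y = 1 / sqrt x], [1 + y^2 <= (1 + y)^2] and [ln (1 + y) <= y]. The logarithmic singularity
    at 0 is thus traded for an integrable power. *)
Lemma ln1DV_le_sqrt {R : realType} (x : R) : 0 < x ->
  ln (1 + x^-1) <= 2 / Num.sqrt x.
Proof.
move=> x0; set y := (Num.sqrt x)^-1.
have y0 : 0 < y by rewrite invr_gt0 sqrtr_gt0.
have -> : x^-1 = y ^+ 2 by rewrite /y exprVn sqr_sqrtr// ltW.
apply: (@le_trans _ _ (ln ((1 + y) ^+ 2))).
  by rewrite ler_ln ?posrE; nra.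
have : ln (1 + y) <= y by apply: le_ln1Dx; rewrite (lt_trans _ y0)// ltrN10.
by rewrite lnXn ?addr_gt0// mulr2n; lra.
Qed.

Lemma powR_le_expR_sqrt {R : realType} (r c : R) : 0 < c ->
  exists2 K, 0 < K & forall x, 1 <= x -> x `^ r <= K * expR (c * Num.sqrt x).
Proof.
move=> c0; pose s := `|r| + 1; have s0 : 0 < s by rewrite ltr_wpDl.
(* This [e] satisfies [2 * s * e = c]. Since [x^s = exp (2 s ln (sqrt x))], applying [ln u < u] to
   [u = e * sqrt x] gives the exponent [c * sqrt x], and the leftover [ln e] goes into the
   constant. *)
pose e := c / (2 * s); have e0 : 0 < e by rewrite divr_gt0// mulr_gt0.
exists (expR (- (2 * s * ln e))); first exact: expR_gt0.
move=> x x1; have x0 : 0 < x by exact: lt_le_trans x1.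
have y0 : 0 < Num.sqrt x by rewrite sqrtr_gt0.
apply: (@le_trans _ _ (x `^ s)).
  by apply: ler_powR => //; rewrite (le_trans (ler_norm r))// lerDl.
rewrite {1}/powR gt_eqF// -expRD ler_expR.
have -> : ln x = 2 * ln (Num.sqrt x).
  by rewrite -{1}(sqr_sqrtr (ltW x0)) lnXn// mulr2n; lra.
have := ln_sublinear (mulr_gt0 e0 y0); rewrite lnM ?posrE// => h.
have -> : c = 2 * s * e by rewrite /e; field; rewrite gt_eqF.
nra.
Qed.

(** * An integrable majorant on the half-line *)

(** Of order [x^(-1/2)] at 0 and [x^(-3/2)] at infinity, hence integrable at both ends. *)
Definition arctan_kernel {R : realType} (x : R) : R :=
  (Num.sqrt x * (1 + x))^-1.

Lemma arctan_kernel_ge0 {R : realType} (x : R) : 0 < x -> 0 <= arctan_kernel x.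
Proof. by move=> x0; rewrite invr_ge0 mulr_ge0 ?sqrtr_ge0// addr_ge0// ltW. Qed.

Lemma continuous_arctan_kernel {R : realType} (x : R) : 0 < x ->
  {for x, continuous (@arctan_kernel R)}.
Proof.
move=> x0; apply: cvgV.
  by rewrite mulf_neq0 ?gt_eqF ?sqrtr_gt0// addr_gt0.
apply: cvgM; first exact: sqrt_continuous.
by apply: cvgD; [exact: cvg_cst|exact: cvg_id].
Qed.

Lemma measurable_arctan_kernel {R : realType} :
  measurable_fun (`]0, +oo[%classic : set R) arctan_kernel.
Proof.
apply: open_continuous_measurable_fun; first exact: interval_open.
by move=> x /[!inE]/=; rewrite in_itv/= andbT; exact: continuous_arctan_kernel.
Qed.

Lemma integral_arctan_kernel_le {R : realType} :
  (\int[lebesgue_measure]_(x in `]0%R, +oo[) (arctan_kernel x)%:E <=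
   (2 * pi : R)%:E)%E.
Proof.
apply: ge0_integral_pos_le.
- exact: measurable_arctan_kernel.
- by move=> x; exact: arctan_kernel_ge0.
move=> a b a0 ab.
have dF (x : R) : 0 < x ->
    is_derive x 1 (fun x => 2 * atan (Num.sqrt x)) (arctan_kernel x).
  move=> x0; have y0 : 0 < Num.sqrt x by rewrite sqrtr_gt0.
  have := is_deriveZ 2 (is_derive1_comp (is_derive1_atan (Num.sqrt x))
    (is_derive1_sqrt x0)).
  rewrite /arctan_kernel sqr_sqrtr ?(ltW x0)// => /is_derive_eq; apply.
  rewrite /GRing.scale/=; field.
  by rewrite !gt_eqF// addr_gt0.
rewrite (derive_FTC2_pos _ _ _ _ a0 ab dF continuous_arctan_kernel) lee_fin.
(* Both values of [atan] lie strictly between [-pi/2] and [pi/2], so twice their difference is below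
   [2 * pi], uniformly in [a] and [b]. *)
have := atan_ltpi2 (Num.sqrt b); have := atan_gtNpi2 (Num.sqrt a).
by lra.
Qed.

(** Comparison test for a weight times a density: [f] covers the region where the weight is at most
    1, the kernel covers the rest, and adding them avoids splitting the domain. *)
Lemma integral_pos_ltey {R : realType} (g f : R -> R) (K : R) :
  measurable_fun (`]0, +oo[%classic : set R) g ->
  measurable_fun (`]0, +oo[%classic : set R) f ->
  (forall x, 0 < x -> 0 <= g x) -> (forall x, 0 < x -> 0 <= f x) -> 0 <= K ->
  (forall x, 0 < x -> g x <= f x + K * arctan_kernel x) ->
  (\int[lebesgue_measure]_(x in `]0%R, +oo[) (f x)%:E < +oo)%E ->
  (\int[lebesgue_measure]_(x in `]0%R, +oo[) (g x)%:E < +oo)%E.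
Proof.
move=> mg mf g0 f0 K0 gf foo.
have pos (x : R) : `]0%R, +oo[%classic x -> 0 < x by rewrite /= in_itv/= andbT.
apply: (@le_lt_trans _ _ (\int[lebesgue_measure]_(x in `]0%R, +oo[)
    ((f x)%:E + (K%:E * (arctan_kernel x)%:E)))%E).
  apply: ge0_le_integral => //.
  - by move=> x /pos x0; rewrite lee_fin g0.
  - exact/measurable_EFinP.
  - apply/measurable_EFinP/measurable_funD => //.
    by apply: measurable_funM => //; exact: measurable_arctan_kernel.
  - by move=> x /pos x0; rewrite -EFinM -EFinD lee_fin gf.
rewrite ge0_integralD//; last 4 first.
- by move=> x /pos x0; rewrite lee_fin f0.
- exact/measurable_EFinP.
- by move=> x /pos x0; rewrite -EFinM lee_fin mulr_ge0// arctan_kernel_ge0.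
- apply: emeasurable_funM => //; apply/measurable_EFinP.
  exact: measurable_arctan_kernel.
rewrite lte_add_pinfty// ge0_integralZl//.
- apply: lte_mul_pinfty => //.
  exact: le_lt_trans integral_arctan_kernel_le (ltry _).
- by apply/measurable_EFinP; exact: measurable_arctan_kernel.
- by move=> x /pos x0; rewrite lee_fin arctan_kernel_ge0.
Qed.

(** * Densities of the form [C * x^q * exp (- sqrt x / b)] *)

Lemma measurable_powR_expR_sqrt {R : realType} (C q b : R) (D : set R) :
  measurable_fun D (fun x : R => C * (x `^ q * expR (- Num.sqrt x / b))).
Proof.
apply: measurable_funTS; apply: measurable_funM => //; apply: measurable_funM.
  exact: measurable_powR.
apply: measurableT_comp => //; apply: measurable_funM => //.
apply: measurableT_comp => //.
by apply: continuous_measurable_fun; exact: sqrt_continuous.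
Qed.

(* If [b <= 0] the exponential factor is at least 1, so the density dominates
   a multiple of 1/x either near 0 or near infinity (according to whether
   [q < -1] or not), and could not have total mass 1. *)
Lemma powR_expR_sqrt_mass1 {R : realType} (C q b : R) :
  (\int[lebesgue_measure]_(x in `]0%R, +oo[)
    (C * (x `^ q * expR (- Num.sqrt x / b)))%:E = 1)%E ->
  0 < C /\ 0 < b.
Proof.
set f := fun x : R => C * (x `^ q * expR (- Num.sqrt x / b)) => f1.
have k0 x : 0 <= x `^ q * expR (- Num.sqrt x / b).
  by rewrite mulr_ge0 ?powR_ge0 ?expR_ge0.
have C0 : 0 < C.
  (* For [C <= 0] the positive part vanishes, and the mass 1 would be minus the integral of a
     nonnegative function. *)
  rewrite ltNge; apply/negP => C0; move: f1; rewrite integralE integral0_eq.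
    rewrite sub0e => /eqP; rewrite eqe_oppLR => /eqP h.
    have : (0 <= -1 :> \bar R)%E.
      by rewrite -h; apply: integral_ge0 => x _; exact: funeneg_ge0.
    by rewrite leNgt lte_fin ltrN10.
  move=> x _; rewrite funeposE; apply/max_idPr.
  by rewrite lee_fin mulr_le0_ge0.
split=> //; rewrite ltNge; apply/negP => b0.
(* On an interval of logarithmic length [2 / C], the function [C / x] already has integral 2, which
   exceeds the total mass. *)
have noitv (u v : R) : 0 < u -> u < v -> ln v - ln u = 2 / C ->
    (forall x, u <= x <= v -> x^-1 <= x `^ q) -> False.
  move=> u0 uv uvC uvq.
  have uvpos x : `[u, v]%classic x -> 0 < x.
    by rewrite /= in_itv/= => /andP[+ _]; exact: lt_le_trans.
  have mV : measurable_fun (`[u, v]%classic : set R) (fun x => x^-1).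
    exact: measurable_fun_inv.
  have : (2%:E <= 1 :> \bar R)%E.
    rewrite -f1.
    apply: (@le_trans _ _ (\int[lebesgue_measure]_(x in `[u, v]) (f x)%:E)%E).
      have -> : 2%:E = (\int[lebesgue_measure]_(x in `[u, v])
          (C%:E * (x^-1)%:E))%E :> \bar R.
        rewrite ge0_integralZl//.
        - by rewrite integral_inv_itv// uvC -EFinM mulrC divfK// gt_eqF.
        - exact/measurable_EFinP.
        - by move=> x /uvpos x0; rewrite lee_fin invr_ge0 ltW.
        - by rewrite lee_fin ltW.
      apply: ge0_le_integral => //.
      - move=> x /uvpos x0.
        by rewrite -EFinM lee_fin mulr_ge0 ?invr_ge0 ?(ltW C0) ?(ltW x0).
      - by apply: emeasurable_funM => //; exact/measurable_EFinP.
      - by apply/measurable_EFinP; exact: measurable_powR_expR_sqrt.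
      - move=> x xuv; rewrite -EFinM lee_fin ler_pM2l//.
        rewrite -[leLHS]mulr1 ler_pM//.
        + by rewrite invr_ge0 ltW// uvpos.
        + by apply: uvq; move: xuv; rewrite /= in_itv.
        (* The case [b = 0] is included: its inverse is 0 and the exponential factor is 1. *)
        + rewrite -expR0 ler_expR mulr_le0// ?oppr_le0 ?sqrtr_ge0//.
          by rewrite invr_le0.
    apply: ge0_subset_integral => //.
    - by apply/measurable_EFinP; exact: measurable_powR_expR_sqrt.
    - by move=> x _; rewrite lee_fin mulr_ge0// ltW.
    - by move=> x /uvpos x0; rewrite /= in_itv/= andbT.
  by rewrite lee_fin leNgt ltr1n.
have C2 : 0 < 2 / C by rewrite divr_gt0.
have [q1|q1] := leP (-1) q.
  apply: (noitv 1 (expR (2 / C))) => //.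
  - by rewrite expR_gt1.
  - by rewrite expRK ln1 subr0.
  - move=> x /andP[x1 _]; rewrite -powR_inv1 ?(le_trans ler01)//.
    exact: ler_powR.
apply: (noitv (expR (- (2 / C))) 1) => //.
- exact: expR_gt0.
- by rewrite expR_lt1 oppr_lt0.
- by rewrite expRK ln1 sub0r opprK.
- move=> x /andP[ux x1]; have x0 := lt_le_trans (expR_gt0 _) ux.
  rewrite -powR_inv1 ?(ltW x0)//; apply: (ger_powR _ (ltW q1)).
  by rewrite x0 x1.
Qed.

Lemma measurable_ln1D {R : realType} (D : set R) :
  measurable_fun D (fun x : R => ln (1 + x)).
Proof.
apply: measurable_funTS; apply: measurableT_comp; first exact: measurable_ln.
exact: measurable_funD.
Qed.

(** For [x <= 1] the weight is at most 1. For [x > 1] the exponential gives [x^3 * f x <= C * K],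
    and [sqrt x * (1 + x) <= 2 * x^2] turns this into a bound of [x * f x] by the kernel. *)
Lemma integral_ln1D_powR_expR_sqrt_ltey {R : realType} (C q b : R) :
  let f x := C * (x `^ q * expR (- Num.sqrt x / b)) in
  (\int[lebesgue_measure]_(x in `]0%R, +oo[) (f x)%:E = 1)%E ->
  (\int[lebesgue_measure]_(x in `]0%R, +oo[) (ln (1 + x) * f x)%:E < +oo)%E.
Proof.
move=> f f1; have [C0 b0] := powR_expR_sqrt_mass1 C q b f1.
have mf (D : set R) : measurable_fun D f by exact: measurable_powR_expR_sqrt.
have f0 x : 0 <= f x.
  by rewrite mulr_ge0 ?(ltW C0)// mulr_ge0 ?powR_ge0 ?expR_ge0.
have bV0 : 0 < b^-1 by rewrite invr_gt0.
(* The exponent is [q] plus the three powers of [x] to be absorbed. *)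
have [K K0 HK] := powR_le_expR_sqrt (q + 3) b^-1 bV0.
apply: (integral_pos_ltey _ f (2 * (C * K))) => //.
- by apply: measurable_funM => //; exact: measurable_ln1D.
- by move=> x x0; rewrite mulr_ge0// ln_ge0// lerDl ltW.
- by rewrite !mulr_ge0// ltW.
- move=> x x0.
  have kx0 := arctan_kernel_ge0 x x0.
  have CK0 : 0 < C * K by rewrite mulr_gt0.
  have lnx : ln (1 + x) <= x.
    by apply: le_ln1Dx; rewrite (lt_trans _ x0)// ltrN10.
  have [x1|x1] := leP x 1.
    have : ln (1 + x) * f x <= 1 * f x by rewrite ler_wpM2r// (le_trans lnx).
    by nra.
  suff : x * f x <= 2 * (C * K) * arctan_kernel x.
    have : ln (1 + x) * f x <= x * f x by rewrite ler_wpM2r.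
    by have := f0 x; lra.
  have y1 : 1 < Num.sqrt x by rewrite -sqrtr1 ltr_sqrt.
  have y0 : 0 < Num.sqrt x by rewrite sqrtr_gt0.
  have yx : Num.sqrt x ^+ 2 = x by rewrite sqr_sqrtr// ltW.
  have fx : x ^+ 3 * f x <= C * K.
    rewrite /f mulrCA ler_pM2l// mulrA -powR_mulrn ?(ltW x0)//.
    rewrite -powRD; last by rewrite [x == 0]gt_eqF ?implybT.
    rewrite [X in x `^ X]addrC mulNr expRN ler_pdivrMr ?expR_gt0//.
    by rewrite [_ / b]mulrC; apply: HK; exact: ltW.
  rewrite /arctan_kernel ler_pdivlMr ?mulr_gt0 ?addr_gt0//.
  (* The denominator is cleared; what remains follows from [sqrt x <= x] and [1 + x <= 2 * x], both
     valid as [x > 1]. *)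
  apply: le_trans (_ : 2 * (x ^+ 3 * f x) <= _); last first.
    by rewrite ler_pM2l.
  set y := Num.sqrt x in y1 y0 yx *.
  have -> : x * f x * (y * (1 + x)) = (x * (y * (1 + x))) * f x by ring.
  have -> : 2 * (x ^+ 3 * f x) = (2 * x ^+ 3) * f x by ring.
  apply: ler_wpM2r => //.
  have -> : 2 * x ^+ 3 = x * (x * (2 * x)) by ring.
  rewrite ler_pM2l// ler_pM ?(ltW y0)//; first by rewrite addr_ge0// ltW.
    by rewrite -yx; nra.
  by lra.
- by rewrite f1 ltry.
Qed.

(** * Logarithmic moments of the channel gains *)

Lemma has_density_on_pos_gt0 {d} {T : measurableType d} {R : realType}
    (P : probability T R) (X : {RV P >-> R}) (f : R -> R) :
  has_density_on_pos X f -> {ae P, forall w, 0 < X w}.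
Proof.
move=> Xf; exists (X @^-1` `]-oo, 0]); split.
- by rewrite -[X in measurable X]setTI; exact: (measurable_funPT X).
- have := Xf `]-oo, 0]%classic (measurable_itv _).
  rewrite (_ : _ `&` _ = set0) ?integral_set0//.
  by apply/seteqP; split => x //= -[]; rewrite !in_itv/= andbT; lra.
- by move=> w /= /negP; rewrite -leNgt in_itv.
Qed.

(** The density is extended by 0 outside the half-line, which makes it nonnegative everywhere, as
    [ge0_integral_RV_density] requires. *)
Lemma integral_has_density_on_pos {d} {T : measurableType d} {R : realType}
    (P : probability T R) (X : {RV P >-> R}) (f : R -> R) (g : R -> \bar R) :
  has_density_on_pos X f -> measurable_fun [set: R] f ->
  (forall x, 0 < x -> 0 <= f x) ->
  measurable_fun [set: R] g -> (forall x, (0 <= g x)%E) ->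
  (\int[P]_w g (X w) =
   \int[lebesgue_measure]_(x in `]0%R, +oo[) (g x * (f x)%:E))%E.
Proof.
move=> Xf mf f0 mg g0; pose D : set R := `]0%R, +oo[%classic.
rewrite (ge0_integral_RV_density _ _ (f \_ D))//.
- rewrite [RHS]integral_mkcond; apply: eq_integral => x _.
  by rewrite /D !patchE; case: ifPn => // _; rewrite mule0.
- apply/measurable_restrict => //; first exact: measurable_itv.
  exact: measurable_funTS.
- by apply: restrict_ge0 => x; rewrite /D/= in_itv/= andbT; exact: f0.
- move=> A mA; rewrite Xf// integral_mkcondr.
  by apply: eq_integral => x _; rewrite /D !patchE; case: ifPn.
Qed.

(** The library density is supported on the closed half-line, so passing to []0, +oo[] discards the
    null point 0. *)
Lemma exponential_has_density_on_pos {d} {T : measurableType d}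
    {R : realType} (P : probability T R) (X : {RV P >-> R}) (m : R) : 0 < m ->
  exponential_with_mean X m -> has_density_on_pos X (exponential_pdf m^-1).
Proof.
move=> m0 Xm A mA; rewrite Xm// /exponential_prob.
rewrite (ge0_negligible_integral
  (N := [set (0 : R)] : set (measurableTypeR R)))//.
- rewrite integral_mkcond [RHS]integral_mkcond; apply: eq_integral => x _.
  rewrite !patchE; have [x0|x0|->] := ltgtP x 0.
  + by rewrite lt0_exponential_pdf// !if_same.
  + congr (if _ then _ else _); apply/idP/idP; rewrite !inE/= in_itv/= andbT.
      by move=> [].
    by move=> [Ax _]; split=> // x00; rewrite x00 ltxx in x0.
  + by rewrite !memNset//=; [rewrite in_itv/= ltxx => -[]|move=> []].
- apply/measurable_EFinP/measurable_funTS; exact: measurable_exponential_pdf.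
- by move=> x _; rewrite lee_fin exponential_pdf_ge0// invr_ge0 ltW.
- exact: lebesgue_measure_set1.
Qed.

Lemma has_density_on_pos_mass1 {d} {T : measurableType d} {R : realType}
    (P : probability T R) (X : {RV P >-> R}) (f : R -> R) :
  has_density_on_pos X f ->
  (\int[lebesgue_measure]_(x in `]0%R, +oo[) (f x)%:E = 1)%E.
Proof. by move/(_ setT measurableT); rewrite setTI probability_setT. Qed.

(** The normalising factor is gathered into one constant [C], whose sign is read off from the total
    mass 1. The absolute value keeps the logarithm nonnegative on the whole line. *)
Lemma cascaded_gain_integrable_ln1D {d} {T : measurableType d} {R : realType}
    (P : probability T R) (X : {RV P >-> R}) (a b : R) :
  has_density_on_pos X (cascaded_gain_pdf a b) ->
  P.-integrable [set: T] (fun w => (ln (1 + `|X w|))%:E).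
Proof.
move=> Xf; set C := (2 * b `^ (a + 1) * Gamma (a + 1))^-1.
have fE : cascaded_gain_pdf a b = fun x =>
    C * (x `^ ((a - 1) / 2) * expR (- Num.sqrt x / b)).
  by apply/funext => x; rewrite /cascaded_gain_pdf -/C mulrAC mulrC.
rewrite fE in Xf; have f1 := has_density_on_pos_mass1 _ _ _ Xf.
have [C0 b0] := powR_expR_sqrt_mass1 _ _ _ f1.
have ln0 (x : R) : 0 <= ln (1 + `|x|) by rewrite ln_ge0// lerDl.
have mln : measurable_fun [set: R] (fun x : R => (ln (1 + `|x|))%:E).
  apply/measurable_EFinP/(measurableT_comp (measurable_ln1D setT)).
  exact: normr_measurable.
apply/integrableP; split.
  exact: (measurableT_comp mln (measurable_funPT X)).
under eq_integral do rewrite /= ger0_norm//.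
rewrite (integral_has_density_on_pos _ _ _
  (fun x : R => (ln (1 + `|x|))%:E) Xf)//.
- rewrite [ltLHS](_ : _ = \int[lebesgue_measure]_(x in `]0%R, +oo[)
      (ln (1 + x) *
        (C * (x `^ ((a - 1) / 2) * expR (- Num.sqrt x / b))))%:E)%E.
    exact: integral_ln1D_powR_expR_sqrt_ltey.
  apply: eq_integral => x; rewrite inE/= in_itv/= andbT => x0.
  by rewrite ger0_norm// ltW.
- exact: measurable_powR_expR_sqrt.
- by move=> x x0; rewrite !mulr_ge0 ?powR_ge0 ?expR_ge0// ltW.
Qed.

Lemma exponential_integrable_ln1DV {d} {T : measurableType d} {R : realType}
    (P : probability T R) (X : {RV P >-> R}) (m : R) : 0 < m ->
  exponential_with_mean X m ->
  P.-integrable [set: T] (fun w => (ln (1 + `|X w|^-1))%:E).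
Proof.
move=> m0 /(exponential_has_density_on_pos _ _ _ m0) Xf.
have r0 : 0 < m^-1 by rewrite invr_gt0.
have f1 := has_density_on_pos_mass1 _ _ _ Xf.
have ln0 (x : R) : 0 <= ln (1 + `|x|^-1) by rewrite ln_ge0// lerDl invr_ge0.
have mln' : measurable_fun [set: R] (fun x : R => ln (1 + `|x|^-1)).
  apply: (measurableT_comp (measurable_ln1D setT)).
  apply: measurable_fun_inv; exact: normr_measurable.
have mln : measurable_fun [set: R] (fun x : R => (ln (1 + `|x|^-1))%:E).
  exact/measurable_EFinP.
have mf := measurable_exponential_pdf m^-1.
have f0 x := exponential_pdf_ge0 (ltW r0) x.
apply/integrableP; split.
  exact: (measurableT_comp mln (measurable_funPT X)).
under eq_integral do rewrite /= ger0_norm//.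
rewrite (integral_has_density_on_pos _ _ _
  (fun x : R => (ln (1 + `|x|^-1))%:E) Xf)//.
under eq_integral do rewrite -EFinM.
(* For [x > 1] the weight is at most [1 / x <= 1]. For [x <= 1] the density is at most [m^-1] and
   the weight at most [2 / sqrt x], which is at most 4 times the kernel since [1 + x <= 2]. *)
apply: (integral_pos_ltey _ (exponential_pdf m^-1) (4 * m^-1)) => //.
- by apply: measurable_funTS; exact: measurable_funM.
- exact: measurable_funTS.
- by move=> x _; rewrite mulr_ge0.
- by rewrite mulr_ge0// ltW.
- move=> x x0; have kx0 := arctan_kernel_ge0 x x0.
  have kr0 : 0 <= 4 * m^-1 * arctan_kernel x by rewrite !mulr_ge0// ltW.
  rewrite ger0_norm ?(ltW x0)//; have [x1|x1] := leP x 1; last first.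
    have : ln (1 + x^-1) * exponential_pdf m^-1 x <= 1 * exponential_pdf m^-1 x.
      apply: ler_wpM2r => //.
      apply: (@le_trans _ _ x^-1); last by rewrite invf_le1// ltW.
      by apply: le_ln1Dx; rewrite (@lt_le_trans _ _ 0) ?ltrN10// invr_ge0 ltW.
    by lra.
  have y0 : 0 < Num.sqrt x by rewrite sqrtr_gt0.
  have -> : 4 * m^-1 * arctan_kernel x = (4 * arctan_kernel x) * m^-1 by ring.
  apply: (@le_trans _ _ (4 * arctan_kernel x * m^-1)); last by rewrite lerDr.
  apply: ler_pM => //.
  + by rewrite ln_ge0// lerDl invr_ge0 ltW.
  + apply: (le_trans (ln1DV_le_sqrt x x0)).
    rewrite /arctan_kernel ler_pdivrMr// invfM mulrA.
    have -> : 4 / Num.sqrt x / (1 + x) * Num.sqrt x = 4 / (1 + x).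
      by field; rewrite !gt_eqF// addr_gt0.
    by rewrite ler_pdivlMr ?addr_gt0//; lra.
  + rewrite exponential_pdfE ?(ltW x0)// ger_pMr// -[leRHS]expR0 ler_expR.
    by rewrite mulNr oppr_le0 mulr_ge0// ltW.
- by rewrite f1 ltry.
Qed.

(** * Logarithms and monotone limits at infinity *)

Lemma measurable_log2 {R : realType} : measurable_fun [set: R] (@log2 R).
Proof. by apply: measurable_funM => //; exact: measurable_ln. Qed.

Lemma ln2_gt0 {R : realType} : 0 < ln 2 :> R.
Proof. by rewrite ln_gt0// ltr1n. Qed.

Lemma cvgy_log2V {R : realType} : (log2 p)^-1 @[p --> +oo] --> (0 : R).
Proof.
have log2_gt0 : \forall p \near +oo, 0 < log2 (p : R).
  near=> p; have p1 : 1 < p by near: p; exact: nbhs_pinfty_gt.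
  by rewrite divr_gt0 ?ln2_gt0// ln_gt0.
apply/(gtr0_cvgV0 log2_gt0).
apply/cvgryPge => A; near=> p; rewrite ler_pdivlMr ?ln2_gt0//.
by rewrite -[leLHS]expRK ler_ln ?posrE ?expR_gt0.
Unshelve. all: by end_near. Qed.

Lemma ln1DM_le {R : realType} (x y : R) : 0 <= x -> 0 <= y ->
  ln (1 + x * y) <= ln (1 + x) + ln (1 + y).
Proof.
move=> x0 y0; rewrite -lnM ?posrE ?ltr_wpDr//.
by rewrite ler_ln ?posrE ?mulr_gt0 ?ltr_wpDr ?mulr_ge0//; nra.
Qed.

Lemma nondecreasing_bounded_cvgy {R : realType} (f : R -> \bar R) (B : \bar R) :
  (forall p q, 1 <= p -> p <= q -> (f p <= f q)%E) ->
  (forall p, 1 <= p -> (0 <= f p <= B)%E) -> (B < +oo)%E ->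
  exists c : R, f p @[p --> +oo%R] --> c%:E.
Proof.
(* Truncating the argument at 1 gives a function monotone on the whole line with the same germ at
   infinity. *)
move=> fnd fB Boo; pose g p := f (Num.max p 1).
have max1 (p : R) : 1 <= Num.max p 1 by rewrite le_max lexx orbT.
have gnd : nondecreasing_fun g.
  move=> p q pq; apply: fnd => //.
  by rewrite ge_max !le_max pq lexx !orbT.
have := nondecreasing_cvge gnd; set l := ereal_sup _ => gl.
have lB : (l <= B)%E.
  by apply: ub_ereal_sup => _ [p _ <-]; case/andP: (fB _ (max1 p)).
have l0 : (0 <= l)%E.
  apply: (@le_trans _ _ (g 0)); first by case/andP: (fB _ (max1 0)).
  by apply: ereal_sup_ubound; exists 0.
exists (fine l); rewrite fineK; last first.
  by rewrite ge0_fin_numE// (le_lt_trans lB).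
apply: cvg_trans gl; apply: near_eq_cvg; near=> p.
by rewrite /g max_l//; near: p; exact: nbhs_pinfty_ge.
Unshelve. all: by end_near. Qed.

(** * Saturation of the ergodic rate *)

Lemma ergodic_rate_saturates {d} {T : measurableType d} {R : realType}
    (P : probability T R) (X Y G : {RV P >-> R}) (k s : R) :
  0 < k -> 0 < s ->
  {ae P, forall w, 0 < X w} -> {ae P, forall w, 0 < Y w} ->
  {ae P, forall w, 0 < G w} ->
  P.-integrable [set: T] (fun w => (ln (1 + `|X w|))%:E) ->
  P.-integrable [set: T] (fun w => (ln (1 + `|Y w|))%:E) ->
  P.-integrable [set: T] (fun w => (ln (1 + `|G w|^-1))%:E) ->
  exists c : R,
    ergodic_rate P (fun w => k * p * (X w * Y w) / (p * G w + s))
      @[p --> +oo] --> c%:E.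
Proof.
move=> k0 s0 X0 Y0 G0 iX iY iG.
(* Absolute values make [L] nonnegative and monotone in [p > 0] at every [w], not just almost
   surely; [rateE] identifies its integral with the rate. *)
pose Z w := k * `|X w| * `|Y w|.
have Z0 w : 0 <= Z w by rewrite !mulr_ge0// ltW.
have den0 p w : 0 < p -> 0 < `|G w| + s / p.
  by move=> p0; rewrite ltr_wpDl// divr_gt0.
pose L p w := log2 (1 + Z w / (`|G w| + s / p)).
pose U w := ln (1 + k) + ln (1 + `|X w|) + ln (1 + `|Y w|) +
  ln (1 + `|G w|^-1).
have L0 p w : 0 < p -> 0 <= L p w.
  move=> p0; rewrite divr_ge0 ?(ltW ln2_gt0)// ln_ge0// lerDl divr_ge0//.
  by rewrite ltW// den0.
have U0 w : 0 <= U w / ln 2.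
  rewrite divr_ge0 ?(ltW ln2_gt0)//.
  by rewrite !addr_ge0// ln_ge0// lerDl ?invr_ge0// ltW.
have mX (V : {RV P >-> R}) : measurable_fun [set: T] V.
  exact: measurable_funPT.
have mN (V : {RV P >-> R}) : measurable_fun [set: T] (fun w => `|V w|).
  by apply: measurableT_comp (mX V); exact: normr_measurable.
have mL p : measurable_fun [set: T] (L p).
  apply: (measurableT_comp measurable_log2); apply: measurable_funD => //.
  apply: measurable_funM; first by do 2 apply: measurable_funM => //.
  by apply: measurable_fun_inv; exact: measurable_funD.
pose rate p := ergodic_rate P (fun w => k * p * (X w * Y w) / (p * G w + s)).
have rateE p : 0 < p -> rate p = (\int[P]_w (L p w)%:E)%E.
  move=> p0; rewrite /rate /ergodic_rate unlock; apply: ae_eq_integral => //.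
  - apply/measurable_EFinP/(measurableT_comp measurable_log2).
    apply: measurable_funD => //; apply: measurable_funM.
      by apply: measurable_funM => //; exact: measurable_funM.
    apply: measurable_fun_inv; apply: measurable_funD => //.
    exact: measurable_funM.
  - exact/measurable_EFinP.
  apply: filterS3 X0 Y0 G0 => w Xw Yw Gw _; congr (log2 (1 + _))%:E.
  rewrite /Z !gtr0_norm//; field.
  by rewrite !gt_eqF ?addr_gt0 ?mulr_gt0.
have Lnd p q w : 0 < p -> p <= q -> L p w <= L q w.
  move=> p0 pq; have q0 : 0 < q by exact: lt_le_trans pq.
  rewrite ler_pM2r ?invr_gt0 ?ln2_gt0// ler_ln ?posrE ?ltr_wpDr//; last 2 first.
  - by rewrite divr_ge0// ltW// den0.
  - by rewrite divr_ge0// ltW// den0.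
  rewrite lerD2l ler_wpM2l// lef_pV2 ?posrE ?den0// lerD2l ler_pM2l//.
  by rewrite lef_pV2.
(* With [G w = 0] the inverse in [U] would be 0 and the bound could fail, so it is claimed only
   where [G w > 0], which is almost everywhere. *)
have LU p w : 0 < p -> 0 < G w -> L p w <= U w / ln 2.
  move=> p0 Gw; rewrite ler_pM2r ?invr_gt0 ?ln2_gt0//.
  apply: (@le_trans _ _ (ln (1 + Z w / `|G w|))).
    rewrite ler_ln ?posrE ?ltr_wpDr//; last 2 first.
    - by rewrite divr_ge0// ltW// den0.
    - by rewrite divr_ge0.
    rewrite lerD2l ler_wpM2l// lef_pV2 ?posrE ?normr_gt0 ?gt_eqF ?den0//.
    by rewrite lerDl divr_ge0// ltW.
  have gV0 : 0 <= `|G w|^-1 by rewrite invr_ge0.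
  have kX0 : 0 <= k * `|X w| by rewrite mulr_ge0// ltW.
  (* The product [k * |X| * |Y| * |G|^-1] is split one factor at a time. *)
  have := ln1DM_le _ _ (Z0 w) gV0.
  have := ln1DM_le _ _ kX0 (normr_ge0 (Y w)).
  have := ln1DM_le _ _ (ltW k0) (normr_ge0 (X w)).
  by rewrite /U /Z; lra.
have iU : P.-integrable [set: T] (fun w => (U w / ln 2)%:E).
  under eq_fun do rewrite EFinM.
  apply: integrableZr => //; rewrite /U.
  do 3 (under eq_fun do rewrite EFinD).
  do 3 (apply: integrableD => //).
  exact: finite_measure_integrable_cst.
have mU : measurable_fun [set: T] (fun w => (U w / ln 2)%:E).
  exact: measurable_int iU.
apply: (nondecreasing_bounded_cvgy rate (\int[P]_w (U w / ln 2)%:E)%E).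
- move=> p q p1 pq; have p0 : 0 < p by exact: lt_le_trans p1.
  have q0 : 0 < q by exact: lt_le_trans pq.
  rewrite !rateE//; apply: ge0_le_integral => //.
  + by move=> w _; rewrite lee_fin L0.
  + exact/measurable_EFinP.
  + exact/measurable_EFinP.
  + by move=> w _; rewrite lee_fin Lnd.
- move=> p p1; have p0 : 0 < p by exact: lt_le_trans p1.
  rewrite rateE//; apply/andP; split.
    by apply: integral_ge0 => w _; rewrite lee_fin L0.
  apply: ae_ge0_le_integral => //.
  + by move=> w _; rewrite lee_fin L0.
  + exact/measurable_EFinP.
  + by move=> w _; rewrite lee_fin.
  + by apply: filterS G0 => w Gw _; rewrite lee_fin LU.
- have /integrableP[_] := iU.
  by under eq_integral do rewrite /= ger0_norm//.
Qed.

Theorem mainTheorem11 (R : realType) (d : measure_display)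
    (T : measurableType d) (P : probability T R)
    (M N : nat)
    (beta an am sigma_a2 sigma2 Omega_RI kappa m_na Omega_na : R)
    (eta alpha dh1 dh2 dg1 dgn : R)
    (zeta_h zeta_g h_RI_sq : {RV P >-> R})
    (hM : (1 <= M)%N) (hN : (1 <= N)%N)
    (hbeta : 1 < beta)
    (han : 0 < an) (ham : 0 < am) (hanm : an + am = 1)
    (hsigma_a2 : 0 < sigma_a2) (hsigma2 : 0 < sigma2)
    (hOmega_RI : 0 < Omega_RI) (hkappa : 0 < kappa)
    (hm_na : 0 < m_na) (hOmega_na : 0 < Omega_na)
    (heta : 0 < eta) (halpha : 0 < alpha)
    (hdh1 : 0 < dh1) (hdh2 : 0 < dh2) (hdg1 : 0 < dg1) (hdgn : 0 < dgn)
    (hzeta_h : has_density_on_pos zeta_h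
       (cascaded_gain_pdf (shape_a N kappa m_na) (scale_b kappa m_na)))
    (hzeta_g : has_density_on_pos zeta_g
       (cascaded_gain_pdf (shape_a M kappa m_na) (scale_b kappa m_na)))
    (hh_RI : exponential_with_mean h_RI_sq Omega_RI)
    (hind : independent P zeta_h zeta_g)
    (hind_RI : independent P h_RI_sq (fun w => (zeta_h w, zeta_g w))) :
  let rate (p : R) : \bar R :=
    ergodic_rate P (fun w =>
      sinr_Dn M beta an sigma_a2 sigma2 Omega_na
        (lambda_n eta alpha dh1 dh2 dg1 dgn) p
        (zeta_h w) (zeta_g w) (h_RI_sq w)) in
  (exists c : R, rate p @[p --> +oo%R] --> c%:E) /\
  ((rate p * ((log2 p)^-1)%:E)%E @[p --> +oo%R] --> 0%E).
Proof.
move=> rate; set lam := lambda_n _ _ _ _ _ _ in rate *.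
have lam0 : 0 < lam.
  by rewrite !mulr_gt0 ?powR_gt0// invr_gt0 exprn_gt0.
have [c rate_c] : exists c : R, rate p @[p --> +oo] --> c%:E.
  (* [s] collects the noise terms of the denominator, which do not grow with [p]. *)
  pose s := beta * sigma_a2 * M%:R * Omega_na + sigma2.
  have beta0 : 0 < beta by exact: lt_trans ltr01 hbeta.
  have s0 : 0 < s by rewrite addr_gt0// !mulr_gt0// ltr0n.
  have k0 : 0 < beta * an / lam by rewrite divr_gt0// mulr_gt0.
  have rateE : rate = fun p => ergodic_rate P (fun w =>
      beta * an / lam * p * (zeta_h w * zeta_g w) / (p * h_RI_sq w + s)).
    apply/funext => p; congr (ergodic_rate P); apply/funext => w.
    by rewrite /sinr_Dn -(addrA (p * _)) -/s; ring.
  have h_RI_density := exponential_has_density_on_pos _ _ _ hOmega_RI hh_RI.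
  rewrite rateE; apply: ergodic_rate_saturates => //.
  - exact: has_density_on_pos_gt0 hzeta_h.
  - exact: has_density_on_pos_gt0 hzeta_g.
  - exact: has_density_on_pos_gt0 h_RI_density.
  - exact: cascaded_gain_integrable_ln1D hzeta_h.
  - exact: cascaded_gain_integrable_ln1D hzeta_g.
  - exact: exponential_integrable_ln1DV hOmega_RI hh_RI.
split; first by exists c.
(* The limit [c] is finite, so its product with the limit 0 of [(log2 p)^-1] is not an indeterminate
   form. *)
have -> : 0%E = (c%:E * 0%:E)%E :> \bar R by rewrite mule0.
apply: cvgeM => //.
by apply: cvg_EFin; [exact: nearW|exact: cvgy_log2V].
Qed.
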